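(* Let $m,n\ge 2$ be natural numbers with $m<n$, and let $G\le \operatorname{Sym}(m)$ and $H\le \operatorname{Sym}(n)$. Suppose that: (1) there exists a prefix code $\widetilde{A}$ of $\mathfrak{C}_m$ with $|\widetilde{A}|=n$; (2) the root group $\mathcal{R}_G(\widetilde{A})$ is well defined; and (3) $\mathcal{R}_G(\widetilde{A})$ and $H$ are cyclically isomorphic. Then $V_n(H)$ embeds (as a group) in $V_m(G)$.
   Context: For $r\ge 2$ let $\mathcal{A}_r=\{0,1,\dots,r-1\}$ with the order $0<1<\dots<r-1$, let $\mathcal{A}_r^*$ be the set of finite words over $\mathcal{A}_r$ (including the empty word), and let $\mathfrak{C}_r=\mathcal{A}_r^{\mathbb{N}}$ (infinite words, product topology; a Cantor space). For $u\in\mathcal{A}_r^*$ and $v$ a finite or infinite word, $uv$ denotes concatenation, and $u\le_{pref} v$ means $v=uw$ for some word $w$. A (complete) prefix code of $\mathfrak{C}_r$ is a finite set $S\subset\mathcal{A}_r^*$ such that every infinite word $\zeta\in\mathfrak{C}_r$ has exactly one $s\in S$ with $s\le_{pref}\zeta$. A permutation $\sigma\in\operatorname{Sym}(r)$ acts on finite or infinite words letterwise: $\sigma(z_1z_2z_3\cdots)=\sigma(z_1)\sigma(z_2)\sigma(z_3)\cdots$. For $H\le\operatorname{Sym}(r)$, the symmetric Thompson group $V_r(H)$ is the group (under composition) of homeomorphisms of $\mathfrak{C}_r$ described by tables: a table consists of two prefix codes $P=\{p_1,\dots,p_k\}$ and $Q=\{q_1,\dots,q_k\}$ of $\mathfrak{C}_r$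 of the same size together with $\sigma_i,\tau_i\in H$ ($1\le i\le k$), and it describes the homeomorphism sending $p_i\,\sigma_i(u)\mapsto q_i\,\tau_i(u)$ for all $u\in\mathfrak{C}_r$ and all $i$ (equivalently $p_iu\mapsto q_i\,\tau_i\sigma_i^{-1}(u)$). Dictionary order on $\mathcal{A}_r^*$: $u\le_{dict}v$ iff $u\le_{pref}v$, or $u=p\alpha s$, $v=p\beta t$ with letters $\alpha<\beta$. Root group: given $G\le\operatorname{Sym}(m)$ and a prefix code $\widetilde{A}=\{a_0,\dots,a_{n-1}\}$ of $\mathfrak{C}_m$ listed in increasing dictionary order, the root group $\mathcal{R}_G(\widetilde{A})$ is well defined if $\sigma(\widetilde{A})=\widetilde{A}$ for every $\sigma\in G$ (letterwise action); it is then the group of permutations of $\widetilde{A}$ induced by the elements of $G$, regarded as a subgroup of $\operatorname{Sym}(n)$ via the bijection $i\mapsto a_i$ from $\mathcal{A}_n$ to $\widetilde{A}$. The cycle type of $\sigma\in\operatorname{Sym}(n)$ is the multiset of lengths of cycles in its cycle decomposition. Two subgroups $H,H'\le\operatorname{Sym}(n)$ are cyclically isomorphic if there is a group isomorphism $\psi:H\to H'$ with $\sigma$ and $\psi(\sigma)$ of the same cycle type for every $\sigma\in H$. *)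

(* Defs.v *)
From mathcomp Require Import all_boot all_fingroup.
Set Implicit Arguments. Unset Strict Implicit. Unset Printing Implicit Defensive.
Local Open Scope group_scope.

Definition cantor (r : nat) := nat -> 'I_r.

Fixpoint cat_inf (r : nat) (u : seq 'I_r) (z : cantor r) : cantor r :=
  match u with
  | [::] => z
  | a :: u' => fun i => if i is j.+1 then cat_inf u' z j else a
  end.

Definition prefix_inf (r : nat) (u : seq 'I_r) (zeta : cantor r) : Prop :=
  exists w : cantor r, forall i, zeta i = cat_inf u w i.

Definition prefix_code (r : nat) (S : seq (seq 'I_r)) : Prop :=
  uniq S /\ forall zeta : cantor r, exists! s, s \in S /\ prefix_inf s zeta.

Definition act_word (r : nat) (s : 'S_r) (u : seq 'I_r) : seq 'I_r := map s u.
Definition act_inf (r : nat) (s : 'S_r) (z : cantor r) : cantor r := fun i => s (z i).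

Definition in_V (r : nat) (H : {group 'S_r}) (f : cantor r -> cantor r) : Prop :=
  exists (P Q : seq (seq 'I_r)) (sig tau : nat -> 'S_r),
    [/\ prefix_code P, prefix_code Q, size P = size Q,
        (forall i, i < size P -> sig i \in H /\ tau i \in H) &
        forall i, i < size P -> forall (u : cantor r) (j : nat),
          f (cat_inf (nth [::] P i) (act_inf (sig i) u)) j
          = cat_inf (nth [::] Q i) (act_inf (tau i) u) j].

Definition dict_le (r : nat) (u v : seq 'I_r) : bool :=
  prefix u v ||
  [exists i : 'I_(size u),
     (take i u == take i v) &&
     (if drop i v is b :: _ then
        (if drop i u is a :: _ then (a < b)%N else false) else false)].

Definition root_well_defined (m : nat) (G : {group 'S_m}) (A : seq (seq 'I_m)) : Prop :=
  forall s, s \in G -> perm_eq [seq act_word s a | a <- A] A.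

(* The root group R_G(A) <= Sym(n): permutations of {0..n-1} induced, via
   i |-> a_i (A listed in increasing dictionary order), by elements of G. *)
Definition root_group (m n : nat) (G : {group 'S_m}) (A : seq (seq 'I_m)) : {set 'S_n} :=
  [set pi : 'S_n | [exists s in G, [forall i : 'I_n,
      nth [::] (sort (@dict_le m) A) (pi i)
      == act_word s (nth [::] (sort (@dict_le m) A) i)]]].

Definition cycle_type (n : nat) (s : 'S_n) : seq nat :=
  sort leq [seq #|pred_of_set X| | X : {set 'I_n} <- enum (porbits s)].

Definition cyc_iso (n : nat) (K H : {set 'S_n}) : Prop :=
  exists psi : 'S_n -> 'S_n,
    [/\ {in K &, forall x y, psi (x * y) = psi x * psi y},
        {in K &, injective psi},
        psi @: K = H &
        {in K, forall x, cycle_type (psi x) = cycle_type x}].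

Definition V_embeds (n m : nat) (H : {group 'S_n}) (G : {group 'S_m}) : Prop :=
  exists phi : (cantor n -> cantor n) -> (cantor m -> cantor m),
    [/\ forall f, in_V H f -> in_V G (phi f),
        forall f g, in_V H f -> in_V H g -> phi (f \o g) = phi f \o phi g &
        forall f g, in_V H f -> in_V H g -> phi f = phi g -> f = g].

(* Main.v *)
(** If [f] in [V_n(H)] has germ [p u |-> q h(u)] at [z], then [h] depends only on
[f] and [z] because [Sym(n)] acts faithfully on letters, and [z |-> h] is a
cocycle. Hence [V_n(H)] acts faithfully on [C_n x Sym(n)] by
[(z, k) |-> (f z, h k)]. In the coordinates [(k^-1 z, k)] this is pure prefix
replacement, [(k^-1 p) u, k |-> ((h k)^-1 q) u, h k], so coding [k] by the word
[k(0) ... k(n-1)] embeds [V_n(H)] in [V_n(1)]. A prefix code of size [n] in [C_m]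
gives a substitution homeomorphism [C_n -> C_m] conjugating [V_n(1)] into
[V_m(1)], which lies in [V_m(G)]. *)
Require Import Defs.
From Stdlib Require Import FunctionalExtensionality ClassicalEpsilon.
From mathcomp Require Import all_boot all_fingroup.
From mathcomp Require Import zify.
Set Implicit Arguments. Unset Strict Implicit. Unset Printing Implicit Defensive.
Local Open Scope group_scope.

(** * Infinite words, prefix codes and tables of prefix replacements *)

Section Words.
Variable r : nat.
Implicit Types (p : seq 'I_r) (z : cantor r) (s t : 'S_r).

Definition tail_inf (k : nat) z : cantor r := fun i => z (k + i)%N.

Lemma cat_inf_lt x0 u z i : (i < size u)%N -> cat_inf u z i = nth x0 u i.
Proof. by elim: u i => [|a u IHu] [|i] //= /IHu. Qed.

Lemma cat_inf_ge u z i : cat_inf u z (size u + i)%N = z i.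
Proof. by elim: u. Qed.

Lemma mkseq_cat_inf u z : mkseq (cat_inf u z) (size u) = u.
Proof.
case: u => // a u; apply: (@eq_from_nth _ a) => [|i]; rewrite size_mkseq // => lti.
by rewrite nth_mkseq // (cat_inf_lt a).
Qed.

Lemma tail_cat_inf u z : tail_inf (size u) (cat_inf u z) = z.
Proof. by apply: functional_extensionality => i; rewrite /tail_inf cat_inf_ge. Qed.

Lemma cat_mkseq_tail k z : cat_inf (mkseq z k) (tail_inf k z) = z.
Proof.
apply: functional_extensionality => i; have [ltik|leki] := ltnP i k.
  by rewrite (cat_inf_lt (z 0)) ?size_mkseq // nth_mkseq.
have := cat_inf_ge (mkseq z k) (tail_inf k z) (i - k).
by rewrite size_mkseq /tail_inf subnKC.
Qed.

Lemma cat_tail p z : mkseq z (size p) = p -> cat_inf p (tail_inf (size p) z) = z.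
Proof. by move=> pz; rewrite -{1}pz cat_mkseq_tail. Qed.

Lemma prefix_infE p z : prefix_inf p z <-> mkseq z (size p) = p.
Proof.
split=> [[w zE]|pz].
  have -> : z = cat_inf p w by apply: functional_extensionality.
  exact: mkseq_cat_inf.
by exists (tail_inf (size p) z) => i; rewrite cat_tail.
Qed.

Lemma cat_inf_inj u z z' : cat_inf u z = cat_inf u z' -> z = z'.
Proof. by move=> /(congr1 (tail_inf (size u))); rewrite !tail_cat_inf. Qed.

Lemma cat_inf_cat u v z : cat_inf (u ++ v) z = cat_inf u (cat_inf v z).
Proof.
by elim: u => //= a u ->; apply: functional_extensionality; case.
Qed.

Lemma cat_inf_cons i w z :
  cat_inf (i :: w) z = cat_inf [:: i] (cat_inf w z).
Proof. by rewrite -cat_inf_cat. Qed.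

Lemma cat_inf_head z :
  z = cat_inf [:: z 0] (tail_inf 1 z).
Proof. by apply: functional_extensionality => -[|j]. Qed.

Lemma act_cat_inf s u z :
  act_inf s (cat_inf u z) = cat_inf (act_word s u) (act_inf s z).
Proof.
by elim: u => //= a u <-; apply: functional_extensionality; case.
Qed.

Lemma act_infM s t z : act_inf (s * t) z = act_inf t (act_inf s z).
Proof. by apply: functional_extensionality => i; rewrite /act_inf permM. Qed.

Lemma act_inf1 z : act_inf 1 z = z.
Proof. by apply: functional_extensionality => i; rewrite /act_inf perm1. Qed.

Lemma act_infK s z : act_inf s^-1 (act_inf s z) = z.
Proof. by rewrite -act_infM mulgV act_inf1. Qed.

Lemma act_infVK s z : act_inf s (act_inf s^-1 z) = z.
Proof. by rewrite -act_infM mulVg act_inf1. Qed.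

(** Splits [exists!] into covering and disjointness, with the prefix relation as an equation between
    finite words, which [pick] can test. *)
Lemma prefix_codeP (S : seq (seq 'I_r)) :
  prefix_code S <->
  [/\ uniq S, forall z, exists2 p, p \in S & mkseq z (size p) = p &
      forall z, {in S &, forall p p', mkseq z (size p) = p ->
                                      mkseq z (size p') = p' -> p = p'}].
Proof.
split=> [[uS S1]|[uS Sex Suq]]; split=> // z.
- by have [p [[Sp /prefix_infE pz] _]] := S1 z; exists p.
- move=> p p' Sp Sp' /prefix_infE pz /prefix_infE p'z.
  have [q [_ q1]] := S1 z.
  by rewrite -(q1 p) // -(q1 p').
- have [p Sp pz] := Sex z; exists p; split=> [|p' [Sp' /prefix_infE p'z]].
    by split=> //; apply/prefix_infE.
  exact: Suq pz p'z.
Qed.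

Lemma prefix_code_decomp (S : seq (seq 'I_r)) z :
  prefix_code S -> exists p u, p \in S /\ z = cat_inf p u.
Proof.
move=> /prefix_codeP[_ Sex _]; have [p Sp pz] := Sex z.
by exists p, (tail_inf (size p) z); rewrite cat_tail.
Qed.

Lemma prefix_code_inj (S : seq (seq 'I_r)) p p' z z' :
  prefix_code S -> p \in S -> p' \in S -> cat_inf p z = cat_inf p' z' -> p = p'.
Proof.
move=> /prefix_codeP[_ _ Suq] Sp Sp' eqpp'.
apply: (Suq (cat_inf p z)) => //; first exact: mkseq_cat_inf.
by rewrite eqpp' mkseq_cat_inf.
Qed.

Lemma prefix_code_nth_inj (S : seq (seq 'I_r)) i j z z' :
  prefix_code S -> (i < size S)%N -> (j < size S)%N ->
  cat_inf (nth [::] S i) z = cat_inf (nth [::] S j) z' -> i = j.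
Proof.
move=> cS ltiS ltjS /(prefix_code_inj cS (mem_nth _ ltiS) (mem_nth _ ltjS))/eqP.
by rewrite nth_uniq //; [move/eqP | case: cS].
Qed.

Definition bij (f : cantor r -> cantor r) :=
  injective f /\ forall z, exists w, f w = z.

(** Injectivity comes from disjointness of the range cylinders, surjectivity from their covering;
    each pair of labels merges into one. *)
Lemma in_V_inv (H : {group 'S_r}) f : in_V H f ->
  bij f /\
  exists T : seq (seq 'I_r * (seq 'I_r * 'S_r)),
    prefix_code (unzip1 T) /\
    forall p q h, (p, (q, h)) \in T -> h \in H /\
      forall u, f (cat_inf p u) = cat_inf q (act_inf h u).
Proof.
case=> P [Q [sig [tau [cP cQ szPQ stH fE]]]].
(* Products apply the left factor first, so this is the usual composite of [tau i] after the inverse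
   of [sig i]. *)
pose h i := (sig i)^-1 * tau i.
have fE' i u : (i < size P)%N ->
    f (cat_inf (nth [::] P i) u) = cat_inf (nth [::] Q i) (act_inf (h i) u).
  move=> ltiP; apply: functional_extensionality => j.
  by rewrite -{1}(act_infVK (sig i) u) fE // act_infM.
have Pz z : exists i u, (i < size P)%N /\ z = cat_inf (nth [::] P i) u.
  have [p [u [Pp ->]]] := prefix_code_decomp z cP.
  by exists (index p P), u; rewrite index_mem nth_index.
split.
  split=> [z z'|z].
    have [i [u [lti ->]]] := Pz z; have [j [v [ltj ->]]] := Pz z'.
    rewrite !fE' // => eqf.
    have eqij : i = j by apply: prefix_code_nth_inj cQ _ _ eqf; rewrite -szPQ.
    move: eqf; rewrite eqij => /cat_inf_inj/(congr1 (act_inf (h j)^-1)).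
    by rewrite !act_infK => ->.
  have [q [u [Qq ->]]] := prefix_code_decomp z cQ.
  exists (cat_inf (nth [::] P (index q Q)) (act_inf (h (index q Q))^-1 u)).
  by rewrite fE' ?szPQ ?index_mem // act_infVK nth_index.
exists (zip P (mkseq (fun i => (nth [::] Q i, h i)) (size P))); split.
  by rewrite unzip1_zip // size_mkseq.
move=> p q k /(nthP ([::], ([::], 1))) [i].
rewrite size_zip size_mkseq minnn => lti.
rewrite nth_zip ?size_mkseq // nth_mkseq // => -[<- <- <-].
have [sH tH] := stH i lti.
by split=> [|u]; [rewrite groupM ?groupV | rewrite fE'].
Qed.

(* For a bijection only the domain code has to be checked: the range words
   then form a prefix code automatically. *)
Lemma in_V_intro (x0 : 'I_r) (G : {group 'S_r}) f
    (T : seq (seq 'I_r * seq 'I_r)) :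
  bij f -> prefix_code (unzip1 T) ->
  (forall p q, (p, q) \in T -> forall u, f (cat_inf p u) = cat_inf q u) ->
  in_V G f.
Proof.
case=> f_inj f_surj cP fE; set P := unzip1 T in cP *; set Q := unzip2 T.
have szP : size P = size T by rewrite size_map.
have szQ : size Q = size T by rewrite size_map.
have fE' i u : (i < size T)%N ->
    f (cat_inf (nth [::] P i) u) = cat_inf (nth [::] Q i) u.
  move=> lti; apply: fE; rewrite !(nth_map ([::], [::])) //.
  by rewrite -surjective_pairing mem_nth.
have Qinj i j u v : (i < size T)%N -> (j < size T)%N ->
    cat_inf (nth [::] Q i) u = cat_inf (nth [::] Q j) v -> i = j.
  move=> lti ltj; rewrite -!fE' // => /f_inj eqf.
  by apply: prefix_code_nth_inj cP _ _ eqf; rewrite szP.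
exists P, Q, (fun=> 1), (fun=> 1); split=> //; first 1 last.
- by rewrite szP szQ.
- by move=> i; rewrite szP => lti u j; rewrite act_inf1 fE'.
apply/prefix_codeP; split=> [|z|z q q'].
(* Equal range words remain equal after appending a constant infinite word, so disjointness of
   cylinders applies. *)
- apply/(uniqP [::]) => i j; rewrite !inE szQ => lti ltj eqij.
  by apply: (Qinj _ _ (fun=> x0) (fun=> x0)); rewrite ?eqij.
- have [w <-] := f_surj z; have [p [u [Pp ->]]] := prefix_code_decomp w cP.
  have lti : (index p P < size T)%N by rewrite -szP index_mem.
  exists (nth [::] Q (index p P)); first by rewrite mem_nth ?szQ.
  by rewrite -{1}(nth_index [::] Pp) fE' // mkseq_cat_inf.
- move=> /(nthP [::])[i + <-] /(nthP [::])[j + <-]; rewrite szQ => lti ltj.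
  move=> /cat_tail zi /cat_tail zj; congr nth.
  exact: Qinj lti ltj (etrans zi (esym zj)).
Qed.

End Words.

(** * The substitution homeomorphism given by a prefix code *)

Section Substitution.
Variables (m n : nat) (x0 : 'I_m) (i0 : 'I_n) (a : 'I_n -> seq 'I_m).
Hypothesis a_gt0 : forall i, (0 < size (a i))%N.
Hypothesis a_cover : forall z, exists i u, z = cat_inf (a i) u.
Hypothesis a_inj : forall i j u v, cat_inf (a i) u = cat_inf (a j) v -> i = j.

Definition subst_word (w : seq 'I_n) : seq 'I_m := flatten [seq a i | i <- w].

(** Since code words are nonempty, [k.+1] letters of [z] already determine letter [k] of the image;
    the default [x0] is never read. *)
Definition subst_inf (z : cantor n) : cantor m :=
  fun k => nth x0 (subst_word (mkseq z k.+1)) k.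

(** Under [a_cover] the search always succeeds, so the default [i0] is never returned. *)
Definition first_letter (z : cantor m) : 'I_n :=
  odflt i0 [pick i | mkseq z (size (a i)) == a i].

Definition drop_letter (z : cantor m) : cantor m :=
  tail_inf (size (a (first_letter z))) z.

Definition desubst_inf (z : cantor m) : cantor n :=
  fun j => first_letter (iter j drop_letter z).

Lemma first_letter_cat i u : first_letter (cat_inf (a i) u) = i.
Proof.
rewrite /first_letter; case: pickP => [j /eqP/cat_tail|/(_ i)] /=.
  by move/a_inj.
by rewrite mkseq_cat_inf eqxx.
Qed.

Lemma drop_letter_cat i u : drop_letter (cat_inf (a i) u) = u.
Proof. by rewrite /drop_letter first_letter_cat tail_cat_inf. Qed.

Lemma desubst_inf_cons i u :
  desubst_inf (cat_inf (a i) u) = cat_inf [:: i] (desubst_inf u).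
Proof.
apply: functional_extensionality => -[|j].
  by rewrite /desubst_inf /= first_letter_cat.
by rewrite /desubst_inf iterSr drop_letter_cat.
Qed.

Lemma size_subst_word w : (size w <= size (subst_word w))%N.
Proof.
elim: w => //= i w IHw; rewrite size_cat.
by rewrite -add1n leq_add.
Qed.

(** A longer prefix of [z] only appends letters to an image that already reaches position [k]. *)
Lemma nth_subst_word (z : cantor n) k l :
  (k < l)%N -> nth x0 (subst_word (mkseq z l)) k = subst_inf z k.
Proof.
move=> ltkl; rewrite /subst_inf -(subnKC ltkl) /mkseq iotaD map_cat.
rewrite /subst_word map_cat flatten_cat nth_cat ifT //.
by have := size_subst_word (mkseq z k.+1); rewrite size_mkseq.
Qed.

Lemma subst_inf_cons i z :
  subst_inf (cat_inf [:: i] z) = cat_inf (a i) (subst_inf z).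
Proof.
apply: functional_extensionality => k.
have mkseq_cons : mkseq (cat_inf [:: i] z) k.+1 = i :: mkseq z k.
  by rewrite /mkseq /= (iotaDl 1 0) -map_comp.
rewrite /subst_inf mkseq_cons [subst_word _]/= -/(subst_inf z).
rewrite nth_cat; have [ltk|lek] := ltnP k (size (a i)).
  by rewrite (cat_inf_lt x0).
rewrite nth_subst_word; first by rewrite -{2}(subnKC lek) cat_inf_ge.
by have := a_gt0 i; lia.
Qed.

Lemma subst_inf_cat w z :
  subst_inf (cat_inf w z) = cat_inf (subst_word w) (subst_inf z).
Proof.
by elim: w => // i w IHw; rewrite cat_inf_cons subst_inf_cons IHw -cat_inf_cat.
Qed.

Lemma desubst_inf_cat w u :
  desubst_inf (cat_inf (subst_word w) u) = cat_inf w (desubst_inf u).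
Proof.
elim: w => // i w IHw.
by rewrite [subst_word _]/= cat_inf_cat desubst_inf_cons IHw -cat_inf_cons.
Qed.

Lemma subst_infK z : desubst_inf (subst_inf z) = z.
Proof.
apply: functional_extensionality => j; elim: j z => [|j IHj] z;
  by rewrite {1}(cat_inf_head z) subst_inf_cons desubst_inf_cons //= IHj.
Qed.

(** Strong induction on the position: stripping a nonempty code word strictly lowers it. *)
Lemma desubst_infK z : subst_inf (desubst_inf z) = z.
Proof.
apply: functional_extensionality => k; elim/ltn_ind: k z => k IHk z.
have [i [u ->]] := a_cover z; rewrite desubst_inf_cons subst_inf_cons.
have [ltk|lek] := ltnP k (size (a i)); first by rewrite !(cat_inf_lt x0).
rewrite -(subnKC lek) !cat_inf_ge IHk //.
by have := a_gt0 i; lia.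
Qed.

Lemma prefix_code_subst (P : seq (seq 'I_n)) :
  prefix_code P -> prefix_code [seq subst_word p | p <- P].
Proof.
move=> cP; case/prefix_codeP: (cP) => uP _ _; apply/prefix_codeP; split=> [|z|].
- rewrite map_inj_in_uniq // => p p' Pp Pp' eqpp'.
  apply: (prefix_code_inj (z := fun=> i0) (z' := fun=> i0) cP) => //.
  apply: (can_inj subst_infK); rewrite !subst_inf_cat eqpp' //.
- have [p [u [Pp zE]]] := prefix_code_decomp (desubst_inf z) cP.
  exists (subst_word p); first exact: map_f.
  by rewrite -(desubst_infK z) zE subst_inf_cat mkseq_cat_inf.
- move=> z _ _ /mapP[p Pp ->] /mapP[p' Pp' ->] /cat_tail zp /cat_tail zp'.
  congr subst_word; have := congr1 desubst_inf (etrans zp (esym zp')).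
  by rewrite !desubst_inf_cat; apply: prefix_code_inj cP Pp Pp'.
Qed.

(** Conjugation by the substitution. Trivial labels matter: a prefix replacement turns into one
    between substituted words, whatever [G] is. *)
Lemma V_embeds_subst (G : {group 'S_m}) : V_embeds (1%G : {group 'S_n}) G.
Proof.
exists (fun f => subst_inf \o f \o desubst_inf); split=> [f||].
- case/in_V_inv=> -[f_inj f_surj] [T [cT fE]].
  pose T' := [seq (subst_word t.1, subst_word t.2.1) | t <- T].
  apply: (@in_V_intro _ x0 _ _ T') => [|| p q].
  + split=> [|z].
      apply: inj_comp (can_inj desubst_infK).
      exact: inj_comp (can_inj subst_infK) f_inj.
    have [w fw] := f_surj (desubst_inf z); exists (subst_inf w).
    by rewrite /= subst_infK fw desubst_infK.
  + have -> : unzip1 T' = [seq subst_word p | p <- unzip1 T].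
      by rewrite /unzip1 -!map_comp.
    exact: prefix_code_subst.
  + case/mapP=> -[p' [q' h]] Tt [-> ->] u /=.
    have [/set1P h1 fE'] := fE _ _ _ Tt.
    by rewrite desubst_inf_cat fE' h1 act_inf1 subst_inf_cat desubst_infK.
- move=> f g _ _; apply: functional_extensionality => z /=.
  by rewrite subst_infK.
- move=> f g _ _ eqfg; apply: functional_extensionality => z.
  apply: (can_inj subst_infK); have := congr1 (fun F => F (subst_inf z)) eqfg.
  by rewrite /= subst_infK.
Qed.

End Substitution.

Lemma V_embeds_prefix_code (m n : nat) (G : {group 'S_m}) (A : seq (seq 'I_m)) :
  (0 < m)%N -> (1 < n)%N -> prefix_code A -> size A = n ->
  V_embeds (1%G : {group 'S_n}) G.
Proof.
move=> m_gt0 n_gt1 cA szA; pose x0 := Ordinal m_gt0.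
pose a (i : 'I_n) := nth [::] A i.
have a_inj i j u v : cat_inf (a i) u = cat_inf (a j) v -> i = j.
  move=> eqij; apply/val_inj; apply: (prefix_code_nth_inj cA _ _ eqij);
  by rewrite szA.
apply: (@V_embeds_subst _ _ x0 (Ordinal (ltnW n_gt1)) a) => // [i|z].
  (* An empty code word is a prefix of every word, so it would be the only one, whereas the letters
     0 and 1 index two. *)
  rewrite lt0n; apply/negP => /nilP ai.
  have eqi j : i = j.
    by apply: (a_inj i j (cat_inf (a j) (fun=> x0)) (fun=> x0)); rewrite ai.
  have := etrans (esym (eqi (Ordinal (ltnW n_gt1)))) (eqi (Ordinal n_gt1)).
  by move/(congr1 val).
have [p [u [Ap ->]]] := prefix_code_decomp z cA.
have ltp : (index p A < n)%N by rewrite -szA index_mem.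
by exists (Ordinal ltp), u; rewrite /a /= nth_index.
Qed.

Lemma V_embeds_trans (l m n : nat) (H : {group 'S_l}) (K : {group 'S_m})
    (G : {group 'S_n}) :
  V_embeds H K -> V_embeds K G -> V_embeds H G.
Proof.
case=> phi [phiV phiM phi_inj] [psi [psiV psiM psi_inj]].
exists (psi \o phi); split=> [f Hf|f g Hf Hg|f g Hf Hg /=].
- by apply/psiV/phiV.
- by rewrite /= phiM // psiM //; apply: phiV.
- by move/psi_inj => eqfg; apply: phi_inj => //; apply: eqfg; apply: phiV.
Qed.

(** * Germs and the lift to the skew product *)

Section Germs.
Variable n : nat.
Implicit Types (f g : cantor n -> cantor n) (z : cantor n) (h k : 'S_n).

(* Near [z], [f] deletes [N] letters, inserts [N'] letters and applies [h] to the
   rest. *)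
Definition has_germ f z h := exists N N', forall w : cantor n,
  (forall i, (i < N)%N -> w i = z i) ->
  (forall i, (i < N')%N -> f w i = f z i) /\
  (forall i, f w (N' + i)%N = h (w (N + i)%N)).

Lemma has_germ_uniq f z h k :
  has_germ f z h -> has_germ f z k -> h = k.
Proof.
move=> [N1 [N1' g1]] [N2 [N2' g2]]; apply/permP => x.
(* This point satisfies both germ conditions and is constantly [x] further on, so a far enough
   letter of [f w] equals both [h x] and [k x]. *)
pose w : cantor n := fun i => if (i < N1 + N2)%N then z i else x.
have [|_ hw] := g1 w; first by move=> i lti; rewrite /w ifT //; lia.
have [|_ kw] := g2 w; first by move=> i lti; rewrite /w ifT //; lia.
have := hw (N2' + (N1 + N2))%N; rewrite addnCA kw /w !ifF //; by lia.
Qed.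

Lemma has_germ_comp f g z h k :
  has_germ g z k -> has_germ f (g z) h -> has_germ (f \o g) z (k * h).
Proof.
move=> [N1 [N1' g1]] [N2 [N2' g2]].
(* Agreement on [N1 + N2] letters makes [g w] and [g z] agree on [N1' + N2]: enough to apply the
   germ of [f], with [N1'] further letters that it maps by [h]. *)
exists (N1 + N2)%N, (N2' + N1')%N => w wz.
have [|gw kw] := g1 w; first by move=> i lti; apply: wz; lia.
have [_ kz] := g1 z (fun _ _ => erefl).
have gwz i : (i < N1' + N2)%N -> g w i = g z i.
  have [/gw-> //|lei] := ltnP i N1' => lti.
  by rewrite -(subnKC lei) kw kz wz //; lia.
have [|fw hw] := g2 (g w); first by move=> i lti; apply: gwz; lia.
have [_ hz] := g2 (g z) (fun _ _ => erefl).
split=> i /= => [lti|].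
  have [/fw-> //|lei] := ltnP i N2'.
  by rewrite -(subnKC lei) hw hz gwz //; lia.
by rewrite -!addnA hw permM -kw addnCA.
Qed.

Lemma has_germ_table f p q h u :
  (forall v, f (cat_inf p v) = cat_inf q (act_inf h v)) ->
  has_germ f (cat_inf p u) h.
Proof.
move=> fE; exists (size p), (size q) => w wp.
have {wp} wE : w = cat_inf p (tail_inf (size p) w).
  rewrite cat_tail //; apply: etrans (mkseq_cat_inf p u).
  by apply/eq_in_map => i; rewrite mem_iota => /wp.
rewrite {}wE !fE; split=> i; last by rewrite !cat_inf_ge.
case: q {fE} => // x q lti; by rewrite !(cat_inf_lt x).
Qed.

(** Meaningful only where a germ exists, as for elements of [V_n(H)]; uniqueness then makes the
    choice irrelevant. *)
Definition germ f z : 'S_n := epsilon (inhabits 1) (has_germ f z).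

Lemma germE f z h : has_germ f z h -> germ f z = h.
Proof. by move=> fzh; apply: (has_germ_uniq _ fzh); apply: epsilon_spec; exists h. Qed.

Lemma in_V_germ (H : {group 'S_n}) f z : in_V H f -> has_germ f z (germ f z).
Proof.
case/in_V_inv=> _ [T [cT fE]].
have [_ [u [/mapP[[p [q h]] Tt ->] ->]]] := prefix_code_decomp z cT.
apply: epsilon_spec; exists h; apply: has_germ_table => v.
by have [_ ->] := fE _ _ _ Tt.
Qed.

(** The cocycle identity, which makes [lift_skew] multiplicative. *)
Lemma germM (H : {group 'S_n}) f g z : in_V H f -> in_V H g ->
  germ (f \o g) z = germ g z * germ f (g z).
Proof.
by move=> Hf Hg; apply/germE/has_germ_comp; apply: in_V_germ; eassumption.
Qed.

(* The code of the point (z, k) of the skew product C_n x Sym(n). *)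
Definition skew k z : cantor n := cat_inf (codom k) (act_inf k^-1 z).

Lemma size_codom_perm k : size (codom k) = n.
Proof. by rewrite size_codom card_ord. Qed.

Lemma codom_perm_inj : injective (fun k => codom k).
Proof.
by move=> h k /eq_in_map eqhk; apply/permP => i; rewrite eqhk ?mem_enum.
Qed.

Lemma mkseq_skew k z : mkseq (skew k z) n = codom k.
Proof.
by have := mkseq_cat_inf (codom k) (act_inf k^-1 z); rewrite size_codom_perm.
Qed.

Lemma tail_skew k z : tail_inf n (skew k z) = act_inf k^-1 z.
Proof.
by have := tail_cat_inf (codom k) (act_inf k^-1 z); rewrite size_codom_perm.
Qed.

Lemma skew_inj k k' z z' : skew k z = skew k' z' -> k = k' /\ z = z'.
Proof.
move=> eqs; have eqk : k = k'.
  by apply: codom_perm_inj; rewrite -(mkseq_skew k z) eqs mkseq_skew.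
split=> //; move: eqs; rewrite eqk => /cat_inf_inj /(congr1 (act_inf k')).
by rewrite !act_infVK.
Qed.

(** The action on the skew product, read through [skew]; points whose first [n] letters do not list
    a permutation are fixed. *)
Definition lift_skew f (z : cantor n) : cantor n :=
  if [pick k : 'S_n | codom k == mkseq z n] is Some k then
    let w := act_inf k (tail_inf n z) in skew (k * germ f w) (f w)
  else z.

Variant skew_spec z : Type :=
  | SkewSpec k w of z = skew k w
  | NoSkewSpec of (forall k, codom k != mkseq z n).

Lemma skewP z : skew_spec z.
Proof.
case: (pickP (fun k : 'S_n => codom k == mkseq z n)) => [k /eqP kz|noz].
  apply: (@SkewSpec _ k (act_inf k (tail_inf n z))).
  by rewrite /skew act_infK -{1}(cat_mkseq_tail n z) kz.
by apply: NoSkewSpec => k; rewrite noz.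
Qed.

Lemma lift_skewE f k z : lift_skew f (skew k z) = skew (k * germ f z) (f z).
Proof.
rewrite /lift_skew; case: pickP => [k'|/(_ k)]; rewrite mkseq_skew ?eqxx //.
by move=> /eqP/codom_perm_inj->; rewrite tail_skew act_infVK.
Qed.

Lemma lift_skew_id f z : (forall k, codom k != mkseq z n) -> lift_skew f z = z.
Proof. by rewrite /lift_skew; case: pickP => // k /[swap]/(_ k)/negPf->. Qed.

Lemma bij_lift_skew f : bij f -> bij (lift_skew f).
Proof.
move=> [f_inj f_surj]; split=> [z z'|z].
  case: (skewP z) (skewP z') => [k w ->|zk] [k' w' ->|zk'].
  - rewrite !lift_skewE => /skew_inj[+ /f_inj eqw].
    by rewrite eqw => /mulIg->.
  - rewrite lift_skewE lift_skew_id // => eqz.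
    by have /eqP[] := zk' (k * germ f w); rewrite -eqz mkseq_skew.
  - rewrite lift_skewE lift_skew_id // => eqz.
    by have /eqP[] := zk (k' * germ f w'); rewrite eqz mkseq_skew.
  - by rewrite !lift_skew_id.
case: (skewP z) => [k w ->|zk]; last by exists z; rewrite lift_skew_id.
(* The germ at the preimage [v] is divided out, so that the lift multiplies it back to [k]. *)
have [v <-] := f_surj w; exists (skew (k * (germ f v)^-1) v).
by rewrite lift_skewE mulgKV.
Qed.

Definition skew_word k (p : seq 'I_n) := codom k ++ act_word k^-1 p.

(** The cylinder of [skew_word k p] is thus exactly the image of the cylinder of [p] in the fibre
    over [k]. *)
Lemma cat_skew_word k p z :
  cat_inf (skew_word k p) z = skew k (cat_inf p (act_inf k z)).
Proof. by rewrite cat_inf_cat /skew act_cat_inf act_infK. Qed.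

(** A row [(p, (q, h))] yields one row per [k], from [skew_word k p] to [skew_word (k * h) q]. Its
    label is trivial: the inverse of [k * h] undoes the [h] applied to the tail. *)
Lemma in_V_lift_skew (x0 : 'I_n) (H : {group 'S_n}) f :
  in_V H f -> in_V (1%G : {group 'S_n}) (lift_skew f).
Proof.
case/in_V_inv=> bf [T [cT fE]].
pose row k (t : seq 'I_n * (seq 'I_n * 'S_n)) :=
  (skew_word k t.1, skew_word (k * t.2.2) t.2.1).
(* The words of length [n] listing no permutation complete the skew words to a prefix code; their
   rows are identities. *)
pose R := [seq val w | w : n.-tuple 'I_n in
  [pred w : n.-tuple 'I_n | [forall k : 'S_n, codom k != val w]]].
pose S := [seq row k t | k <- enum 'S_n, t <- T].
apply: (@in_V_intro _ x0 _ _ (S ++ [seq (w, w) | w <- R])).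
- exact: bij_lift_skew.
- have -> : unzip1 (S ++ [seq (w, w) | w <- R]) =
            [seq skew_word k p | k <- enum 'S_n, p <- unzip1 T] ++ R.
    rewrite /unzip1 map_cat -(map_comp fst) (@eq_map _ _ (fst \o _) id) // map_id.
    by rewrite map_allpairs allpairs_mapr.
  have memR z : (mkseq z n \in R) = [forall k : 'S_n, codom k != mkseq z n].
    apply/imageP/idP => [[w nw ->] //|nz].
    by exists (Tuple (introT eqP (size_mkseq z n))).
  have szR w : w \in R -> size w = n by case/imageP=> t _ ->; rewrite size_tuple.
  (* The two families have disjoint cylinders: a skew word begins with [codom k], which [R]
     excludes. *)
  have skewNR k p z w : w \in R -> mkseq z (size w) = w ->
      mkseq z (size (skew_word k p)) = skew_word k p -> False.
    move=> Rw; rewrite (szR w Rw) => zw /cat_tail; rewrite cat_skew_word => zE.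
    move: Rw; rewrite -zw memR => /forallP/(_ k).
    by rewrite -zE mkseq_skew eqxx.
  apply/prefix_codeP; split=> [|z|z].
  + rewrite cat_uniq; apply/and3P; split.
    * apply: allpairs_uniq; rewrite ?enum_uniq //; first by case: cT.
      move=> _ _ /allpairsP[[k p] /= [_ Tp ->]]
             /allpairsP[[k' p'] /= [_ Tp' ->]] eqkp.
      have /= := congr1 (fun w : seq 'I_n => cat_inf w (fun=> x0)) eqkp.
      rewrite !cat_skew_word => /skew_inj[-> eqpp'].
      by rewrite (prefix_code_inj cT Tp Tp' eqpp').
    * apply/hasPn => w Rw; apply/negP => /allpairsP[[k p] /= [_ Tp wE]].
      apply: (skewNR k p (cat_inf w (fun=> x0)) w Rw);
        by rewrite -?wE mkseq_cat_inf.
    * rewrite map_inj_uniq ?enum_uniq //; exact: val_inj.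
  + case: (skewP z) => [k w ->|zk].
      have [p [u [Tp ->]]] := prefix_code_decomp w cT.
      exists (skew_word k p).
        rewrite mem_cat; apply/orP; left; apply/allpairsP.
        by exists (k, p); rewrite mem_enum.
      by rewrite -(act_infVK k u) -cat_skew_word mkseq_cat_inf.
    exists (mkseq z n); last by rewrite size_mkseq.
    by rewrite mem_cat memR; apply/orP; right; apply/forallP.
  + move=> w w'; rewrite !mem_cat => /orP[Sw|Rw] /orP[Sw'|Rw'] zw zw'.
    * move: Sw Sw' zw zw'.
      move=> /allpairsP[[k p] /= [_ Tp ->]] /allpairsP[[k' p'] /= [_ Tp' ->]].
      move=> /cat_tail zw /cat_tail zw'; have := etrans zw (esym zw').
      rewrite !cat_skew_word => /skew_inj[-> eqpp'].
      by rewrite (prefix_code_inj cT Tp Tp' eqpp').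
    * case/allpairsP: Sw zw => -[k p] /= [_ _ ->] zw.
      by case: (skewNR k p z w').
    * case/allpairsP: Sw' zw' => -[k p] /= [_ _ ->] zw'.
      by case: (skewNR k p z w).
    * by rewrite -zw -zw' !szR.
- move=> p q; rewrite mem_cat => /orP[].
    case/allpairsP=> -[k [p' [q' h]]] /= [_ Tt [-> ->]] u.
    have [_ fE'] := fE _ _ _ Tt; rewrite !cat_skew_word lift_skewE fE' act_infM.
    by rewrite (germE (has_germ_table _ fE')).
  case/mapP=> w Rw [-> ->] u; apply: lift_skew_id => k.
  case/imageP: Rw => t /forallP nt ->.
  by have := mkseq_cat_inf (val t) u; rewrite size_tuple => ->; apply: nt.
Qed.

Lemma V_embeds_1 (x0 : 'I_n) (H : {group 'S_n}) : V_embeds H (1%G : {group 'S_n}).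
Proof.
exists lift_skew; split=> [f Hf|f g Hf Hg|f g Hf Hg eqfg].
- exact: in_V_lift_skew Hf.
- apply: functional_extensionality => z /=.
  case: (skewP z) => [k w ->|zk]; last by rewrite !lift_skew_id.
  by rewrite !lift_skewE (germM _ Hf Hg) mulgA.
- apply: functional_extensionality => z.
  (* The second coordinate of the lift on the fibre over 1 recovers [f], whence faithfulness. *)
  have := congr1 (fun F => F (skew 1 z)) eqfg.
  by rewrite /= !lift_skewE => /skew_inj[].
Qed.

End Germs.

Theorem theorem1p1 (m n : nat) (G : {group 'S_m}) (H : {group 'S_n})
  (A : seq (seq 'I_m)) :
  (2 <= m)%N -> (2 <= n)%N -> (m < n)%N ->
  prefix_code A -> size A = n ->
  root_well_defined G A ->
  cyc_iso (root_group n G A) H ->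
  V_embeds H G.
Proof.
move=> m_gt1 n_gt1 _ cA szA _ _.
(* The intermediate group is [V_n(1)]: the code [A] carries it into [V_m(G)], and the skew product
   carries [V_n(H)] into it. *)
apply: V_embeds_trans (V_embeds_prefix_code G (ltnW m_gt1) n_gt1 cA szA).
exact: V_embeds_1 (Ordinal (ltnW n_gt1)) H.
Qed.
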